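(* Let $G$ be a connected graph with order $n$, let $\mu(G)$ be its matching number, and let $\alpha\in[1/2,1]$. (I) If $n>2\mu(G)$, then $\lambda_{\mu(G)}(A_{\alpha}(G))>1$. (II) If $n=2\mu(G)$, then $\lambda_{\mu(G)-1}(A_{\alpha}(G))>1$.
   Context: All graphs are finite, simple and undirected. For a graph $G$ with adjacency matrix $A(G)$ and diagonal degree matrix $D(G)$, and a real $\alpha\in[0,1]$, $A_{\alpha}(G)=\alpha D(G)+(1-\alpha)A(G)$. Its eigenvalues are denoted $\lambda_1(A_\alpha(G))\geq\cdots\geq\lambda_n(A_\alpha(G))$. The matching number $\mu(G)$ is the maximum number of pairwise disjoint edges in $G$. *)

(* Defs.v *)
From mathcomp Require Import all_boot all_order all_algebra.
From mathcomp Require Import reals.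
From mathcomp Require Import polyrcf.

Set Implicit Arguments.
Unset Strict Implicit.
Unset Printing Implicit Defensive.

Import Order.TTheory GRing.Theory Num.Theory.
Local Open Scope ring_scope.

Definition simple_graph (V : finType) (e : rel V) : Prop :=
  symmetric e /\ irreflexive e.

(* The graph without vertices is not connected. *)
Definition connected_graph (V : finType) (e : rel V) : Prop :=
  (0 < #|V|)%N /\ (forall x y : V, connect e x y).

Definition edges (V : finType) (e : rel V) : {set {set V}} :=
  [set [set p.1; p.2] | p in [set p : V * V | e p.1 p.2]].

Definition is_matching (V : finType) (e : rel V) (M : {set {set V}}) : bool :=
  (M \subset edges e) && trivIset M.

Definition matching_number (V : finType) (e : rel V) : nat :=
  \max_(M : {set {set V}} | is_matching e M) #|M|.

Definition degree (V : finType) (e : rel V) (x : V) : nat :=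
  #|[set y | e x y]|.

(* Rows and columns are indexed by the vertices through enum_val; another
   numbering gives a permutation-similar matrix. *)
Definition adjacency_mx (R : realType) (V : finType) (e : rel V) : 'M[R]_#|V| :=
  \matrix_(i, j) (e (enum_val i) (enum_val j))%:R.

Definition degree_mx (R : realType) (V : finType) (e : rel V) : 'M[R]_#|V| :=
  diag_mx (\row_i (degree e (enum_val i))%:R).

Definition Aalpha (R : realType) (V : finType) (e : rel V) (alpha : R) :
    'M[R]_#|V| :=
  alpha *: degree_mx R e + (1 - alpha) *: adjacency_mx R e.

(* The real eigenvalues of A, each repeated according to its multiplicity as a
   root of the characteristic polynomial, in nonincreasing order.  A symmetric
   n x n matrix has exactly n of them. *)
Definition eigenvalues (R : realType) (n : nat) (A : 'M[R]_n) : seq R :=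
  let p := char_poly A in
  sort >=%R (flatten [seq nseq (mup x p) x | x <- rootsR p]).

(* lambda k A is the k-th largest eigenvalue, counted from 1; it is meaningful
   only for 1 <= k <= n (k = 0 would read the same entry as k = 1). *)
Definition lambda (R : realType) (n : nat) (k : nat) (A : 'M[R]_n) : R :=
  nth 0 (eigenvalues A) k.-1.

(* Main.v *)
(** Let [M] be a matching that misses some vertex, and consider the vectors that
are constant on each edge of [M] and vanish off [M].  With
q(u,v) = alpha (x_u^2 + x_v^2) / 2 + (1 - alpha) x_u x_v >= (x_u + x_v)^2 / 4,
the form x A_alpha x^T is the sum over vertices u of the sums of q(u,v) over the
neighbours v of u.  Each matching edge uv contributes q(u,v) = x_u^2 to the row of u,
so the form is at least |x|^2; by connectivity a nonzero x has an edge between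
its support and its zero set, which makes the inequality strict.  By
Courant-Fischer the |M|-th eigenvalue exceeds 1.  Part (I) takes a maximum
matching; part (II) takes a perfect matching minus one edge. *)

Require Import Defs.
From mathcomp Require Import all_boot all_order all_algebra.
From mathcomp Require Import reals polyrcf complex ring lra zify.

Set Implicit Arguments.
Unset Strict Implicit.
Unset Printing Implicit Defensive.

Import Order.TTheory GRing.Theory Num.Theory.
Local Open Scope ring_scope.
Local Open Scope sesquilinear_scope.

Local Notation toC := (real_complex _).

(** * Sorted eigenvalues and their multiplicities *)

(** Both lists contain each [x] as often as its multiplicity in [p]. This identifies [eigenvalues]
    with the spectral diagonal once the characteristic polynomial splits. *)
Lemma perm_roots_mup (R : rcfType) (s : seq R)
    (p := \prod_(x <- s) ('X - x%:P)) :
  perm_eq (flatten [seq nseq (mup x p) x | x <- rootsR p]) s.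
Proof.
have p0 : p != 0 by rewrite monic_neq0 ?monic_prod_XsubC.
apply/allP => x _ /=; apply/eqP.
rewrite count_flatten sumnE !big_map.
under eq_bigr => y _ do rewrite count_nseq /= mulnbl mu_prod_XsubC.
rewrite -big_mkcond /= -big_filter (eq_filter (a2 := pred1 x)) //.
have [xr|xr] := boolP (x \in rootsR p).
  by rewrite filter_pred1_uniq ?uniq_roots // big_seq1.
rewrite (eq_in_filter (a2 := pred0)) => [|y yr /=]; last first.
  by apply/negbTE; apply: contraNneq xr => <-.
rewrite filter_pred0 big_nil; apply/esym/count_memPn; rewrite -root_prod_XsubC.
apply: contra xr => px; have /(_ x) := roots_on_rootsR p0.
by rewrite inE /= -/p in px * => <-.
Qed.

(** If the entry at [k.-1] were at most [t], so would be all later ones, leaving at most [k.-1]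
    entries above [t]. *)
Lemma lt_nth_sort_ge (d : Order.disp_t) (T : orderType d) (x0 t : T)
    (s : seq T) (k : nat) :
  (0 < k <= count (fun x => t < x)%O s)%N ->
  (t < nth x0 (sort >=%O s) k.-1)%O.
Proof.
case: k => // k /= kc; rewrite ltNge; apply/negP => le_t.
set r := sort _ s in le_t.
have srt : sorted >=%O r by apply: sort_sorted => x y; exact: le_total.
have k_lt : (k < size r)%N.
  by rewrite size_sort (leq_trans kc) ?count_size.
have : (count (fun x => t < x)%O r <= k)%N.
  rewrite -[r](cat_take_drop k) count_cat.
  rewrite (_ : count _ (drop k r) = 0%N) ?addn0.
    by rewrite (leq_trans (count_size _ _)) // size_take k_lt.
  apply/eqP; rewrite -leqn0 leqNgt -has_count -all_predC.
  apply/(all_nthP x0) => i; rewrite size_drop => i_lt /=.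
  rewrite -leNgt nth_drop (le_trans _ le_t) //.
  apply: (sorted_leq_nth _ _ _ srt) => //; last exact: leq_addr.
  - by move=> a b c /= ba ab; apply: le_trans ab ba.
  - by move=> a /=.
  - by rewrite inE -ltn_subRL.
by rewrite count_sort leqNgt kc.
Qed.

(** * Spectral theorem and Courant-Fischer bound *)

Lemma char_poly_similar (F : fieldType) (n : nat) (P A B : 'M[F]_n) :
  P \in unitmx -> A = invmx P *m B *m P -> char_poly A = char_poly B.
Proof.
move=> Pu ->; rewrite /char_poly /char_poly_mx.
rewrite (_ : _ - _ = map_mx polyC (invmx P) *m ('X%:M - map_mx polyC B) *m
                       map_mx polyC P).
  by rewrite !det_mulmx mulrC mulrA -det_mulmx -map_mxM mulmxV // map_mx1 det1 mul1r.
rewrite mulmxBr mulmxBl -!map_mxM; congr (_ - _).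
by rewrite scalar_mxC -mulmxA -map_mxM mulVmx // map_mx1 mulmx1.
Qed.

(** Over [R[i]] the matrix is Hermitian, so its spectral diagonal is real and descends to [R]; [P]
    stays complex. *)
Lemma real_symmetric_spectral (R : rcfType) (n : nat) (A : 'M[R]_n) :
  A^T = A ->
  exists (d : 'rV[R]_n) (P : 'M[R[i]]_n),
    P \is unitarymx /\ map_mx toC A = P^t* *m diag_mx (map_mx toC d) *m P.
Proof.
move=> As; set B := map_mx toC A.
have Bh : B \is hermsymmx.
  apply: realsym_hermsym.
    by apply/is_hermitianmxP; rewrite expr0 scale1r map_mx_id // /B map_trmx As.
  by apply/mxOverP => i j; rewrite mxE; apply/complex_realP; eexists.
exists (map_mx (@complex.Re R) (spectral_diag B)), (spectralmx B); split.
  exact: spectral_unitarymx.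
have -> : map_mx toC (map_mx (@complex.Re R) (spectral_diag B)) = spectral_diag B.
  rewrite -map_mx_comp map_mx_id_in // => i j; apply: RRe_real.
  exact: (mxOverP (hermitian_spectral_diag_real Bh)).
rewrite -invmx_unitary ?spectral_unitarymx //.
exact/orthomx_spectralP/hermitian_normalmx.
Qed.

(** The cross terms of real and imaginary part cancel by symmetry. This carries positivity from real
    to complex vectors, as the complex [P] requires. *)
Lemma complex_form_real_symmetric (R : rcfType) (k : nat) (X : 'M[R]_k)
    (c : 'rV[R[i]]_k)
    (a := map_mx (@complex.Re R) c) (b := map_mx (@complex.Im R) c) :
  X^T = X ->
  (c *m map_mx toC X *m c^t*) 0 0 =
  toC ((a *m X *m a^T) 0 0 + (b *m X *m b^T) 0 0).
Proof.
move=> Xs.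
have cE : c = map_mx toC a + 'i%C *: map_mx toC b.
  by apply/rowP => j; rewrite !mxE -complexE.
have cE' : c^t* = map_mx toC a^T - 'i%C *: map_mx toC b^T.
  apply/colP => j; rewrite !mxE; case: (c 0 j) => x y /=.
  by apply/eqP; rewrite eq_complex /=; apply/andP; split; apply/eqP; ring.
have com : (b *m X *m a^T) 0 0 = (a *m X *m b^T) 0 0.
  have -> : b *m X *m a^T = (a *m X *m b^T)^T by rewrite !trmx_mul trmxK Xs mulmxA.
  by rewrite mxE.
rewrite cE' cE !mulmxDl !mulmxBr -!scalemxAl -!scalemxAr -!map_mxM scalerA -expr2.
rewrite sqr_i scaleN1r opprK.
move: (a *m X *m a^T) (a *m X *m b^T) (b *m X *m a^T) (b *m X *m b^T) com.
by move=> M1 M2 M3 M4 com; rewrite !mxE com rmorphD /=; ring.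
Qed.

(** Were fewer than [k] eigenvalues above [t], some nonzero combination of the rows of [W] would
    avoid their eigenvectors, and the form would be nonpositive there. *)
Lemma lt_lambda_of_form (R : realType) (n k : nat) (t : R) (A : 'M[R]_n)
    (W : 'M[R]_(k, n)) :
  A^T = A -> (0 < k)%N ->
  (forall c : 'rV_k, c != 0 -> 0 < (c *m (W *m (A - t%:M) *m W^T) *m c^T) 0 0) ->
  t < lambda k A.
Proof.
move=> As k0 posX.
have [d [P [Pu Ad]]] := real_symmetric_spectral As.
have chA : char_poly A = \prod_(x <- codom (d 0)) ('X - x%:P).
  (* The diagonalizing [P] is complex, so the polynomials are compared over [R[i]]. *)
  apply: (map_poly_inj (real_complex R)).
  rewrite map_char_poly rmorph_prod (char_poly_similar (P := P)
    (B := diag_mx (map_mx toC d))) ?unitarymx_unit //; last first.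
    by rewrite Ad invmx_unitary.
  rewrite char_poly_trig ?diag_mx_is_trig // big_map big_enum /=.
  by apply: eq_bigr => i _; rewrite !mxE eqxx mulr1n rmorphB /= map_polyX map_polyC.
rewrite /lambda /eigenvalues; apply: lt_nth_sort_ge; rewrite k0 /=.
rewrite chA (permP (perm_roots_mup _)) leqNgt; apply/negP => lt_k.
set S := [set i | t < d 0 i].
have {lt_k}lt_k : (#|S| < k)%N.
  rewrite (leq_ltn_trans _ lt_k) // count_map enumT -size_filter cardE.
  apply: eq_leq; rewrite {1}/enum_mem; congr size.
  by apply: eq_filter => i; rewrite /= inE.
pose N := colsub (fun j : 'I_#|S| => enum_val j) (map_mx toC W *m P^t*).
(* Fewer than [k] equations: some complex combination of the rows of [W] is
   orthogonal to all eigenvectors with eigenvalue above [t]. *)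
have [c c0 cN] : exists2 c : 'rV_k, c != 0 & c *m N = 0.
  have /rowV0Pn[c cK c0] : kermx N != 0.
    by rewrite -mxrank_eq0 mxrank_ker -lt0n subn_gt0 (leq_ltn_trans (rank_leq_col _)).
  by exists c => //; apply/sub_kermxP.
pose y := c *m (map_mx toC W *m P^t*).
have yS i : t < d 0 i -> y 0 i = 0.
  move=> ti; have iS : i \in S by rewrite inE.
  have /rowP/(_ (enum_rank_in iS i)) := cN.
  by rewrite /N mulmx_colsub -/y mxE [RHS]mxE enum_rankK_in // => <-.
(* In eigenvector coordinates the form is the sum of [(d 0 i - t) * |y 0 i|^2]. *)
have XE : map_mx toC (W *m (A - t%:M) *m W^T) =
    map_mx toC W *m P^t* *m diag_mx (map_mx toC d - const_mx (toC t)) *m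
    (map_mx toC W *m P^t*)^t*.
  have -> : (map_mx toC W *m P^t*)^t* = P *m map_mx toC W^T.
    rewrite trmx_mul map_mxM trmxCK; congr (_ *m _).
    by apply/matrixP => u v; rewrite !mxE; exact: conjc_real.
  rewrite !map_mxM map_mxB Ad map_scalar_mx [diag_mx (_ - _)]linearB /= diag_const_mx.
  rewrite !mulmxA; congr (_ *m _); rewrite -!mulmxA; congr (_ *m _).
  rewrite mulmxBl mulmxBr; congr (_ - _).
  by rewrite mul_scalar_mx -scalemxAr -invmx_unitary // mulVmx ?unitarymx_unit // scalemx1.
set X := W *m _ *m _ in posX XE.
have Xs : X^T = X by rewrite !trmx_mul trmxK linearB /= As tr_scalar_mx mulmxA.
have := complex_form_real_symmetric c Xs.
set a := map_mx _ c; set b := map_mx _ c => cE.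
have pos : 0 < (a *m X *m a^T) 0 0 + (b *m X *m b^T) 0 0.
  have nneg (v : 'rV_k) : 0 <= (v *m X *m v^T) 0 0.
    have [->|v0] := eqVneq v 0; first by rewrite !mul0mx mxE.
    exact/ltW/posX.
  have [a0|a0] := eqVneq a 0; last by rewrite ltr_wpDr // posX.
  have [b0|b0] := eqVneq b 0; last by rewrite ltr_wpDl // posX.
  case/eqP: c0; apply/rowP => j.
  have /rowP/(_ j) := a0; have /rowP/(_ j) := b0; rewrite !mxE.
  by case: (c 0 j) => u v /= -> ->.
(* Terms with [d 0 i] above [t] vanish by [yS]; the others have a nonpositive factor. *)
have : toC ((a *m X *m a^T) 0 0 + (b *m X *m b^T) 0 0) <= 0.
  rewrite -cE XE !mulmxA -(mulmxA c) -/y -mulmxA.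
  have -> : (map_mx toC W *m P^t*)^t* *m c^t* = y^t*.
    by rewrite /y [in RHS]trmx_mul map_mxM.
  move: (y) yS => z zS.
  rewrite mul_mx_diag mxE sumr_le0 // => i _; rewrite !mxE.
  have [ti|ti] := ltP t (d 0 i); first by rewrite zS // !mul0r.
  rewrite mulrAC mulr_ge0_le0 ?mul_conjC_ge0 //.
  by rewrite subr_le0 lecR.
by rewrite lecR leNgt pos.
Qed.

(** * Strict lower bound for the quadratic form on a graph *)

(** The partner hypothesis is all that is kept of the matching; [w] and [z] ensure that some edge
    leaves the support of [f]. *)
Lemma signless_form_gt (R : realFieldType) (V : finType) (e : rel V) (alpha : R)
    (f : V -> R) (w z : V) :
  symmetric e -> (forall x y, connect e x y) ->
  1 / 2 <= alpha -> alpha <= 1 ->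
  (forall u, f u != 0 -> exists2 v, e u v & f v = f u) ->
  f w = 0 -> f z != 0 ->
  \sum_u f u ^+ 2 <
  \sum_u \sum_v (e u v)%:R * (alpha * f u ^+ 2 + (1 - alpha) * (f u * f v)).
Proof.
move=> e_sym e_conn al_ge al_le partner fw fz.
pose q u v := alpha * ((f u ^+ 2 + f v ^+ 2) / 2) + (1 - alpha) * (f u * f v).
have q_ge0 u v : 0 <= q u v.
  (* Both coefficients are nonnegative because [alpha] is at least 1/2. *)
  have -> : q u v = (alpha - 1 / 2) / 2 * (f u - f v) ^+ 2 + (f u + f v) ^+ 2 / 4.
    by rewrite /q; field.
  by apply: addr_ge0; apply: mulr_ge0; rewrite ?sqr_ge0 //; lra.
have -> : \sum_u \sum_v (e u v)%:R * (alpha * f u ^+ 2 + (1 - alpha) * (f u * f v)) =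
    \sum_u \sum_v (e u v)%:R * q u v.
  (* Averaging the square term over the two ends of an edge changes the summand by [g u v - g v u],
     whose double sum is zero. *)
  pose g u v := (e u v)%:R * (alpha / 2 * f u ^+ 2).
  apply/eqP; rewrite -subr_eq0 -sumrB.
  under eq_bigr => u _.
    rewrite -sumrB.
    under eq_bigr => v _.
      rewrite (_ : _ - _ = g u v - g v u); last by rewrite /g /q (e_sym v u); field.
      over.
    rewrite sumrB.
    over.
  by rewrite sumrB [X in _ - X]exchange_big subrr.
pose r u := \sum_v (e u v)%:R * q u v.
have t_ge0 u v : 0 <= (e u v)%:R * q u v by rewrite mulr_ge0.
have q_diag u v : f v = f u -> q u v = f u ^+ 2 by move=> fE; rewrite /q fE; field.
have r_ge u : f u ^+ 2 <= r u.
  have [fu|fu] := eqVneq (f u) 0; first by rewrite fu expr0n sumr_ge0.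
  have [v uv fv] := partner u fu.
  by rewrite /r (bigD1 v) //= uv mul1r q_diag // lerDl sumr_ge0.
have [u [v [uv fu fv]]] :
    exists u v, [/\ e u v, f u != 0 & f v = 0].
  have [/existsP[u /existsP[v /and3P[uv fu /eqP fv]]]|no] :=
    boolP [exists u, exists v, [&& e u v, f u != 0 & f v == 0]].
    by exists u, v.
  (* Without such an edge the zero set is closed under adjacency, so connectivity puts [z] in it. *)
  have cl : closed e [pred x | f x == 0].
    apply: (intro_closed (sym_connect_sym e_sym)) => x y xy; rewrite !inE => fx.
    apply: contraNT no => fy; apply/existsP; exists y; apply/existsP; exists x.
    by rewrite e_sym xy fy fx.
  have := closed_connect cl (e_conn w z).
  by rewrite !inE fw eqxx (negbTE fz).
(* The partner [m] already gives [f u ^+ 2]; [v] differs from [m] since [f v = 0], and adds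
   [alpha * f u ^+ 2 / 2]. *)
have r_gt : f u ^+ 2 < r u.
  have [m um fm] := partner u fu.
  have vm : v != m by apply: contraNneq fu => vm; rewrite -fm -vm fv.
  rewrite /r (bigD1 m) //= (bigD1 v) //= um uv !mul1r q_diag // ltrDl ltr_wpDr //.
    by rewrite sumr_ge0.
  have : 0 < f u ^+ 2 by rewrite exprn_even_gt0.
  rewrite /q fv; move: (f u ^+ 2) => s s0.
  rewrite mulr0 mulr0 addr0 expr0n addr0 mulr_gt0 //; lra.
rewrite (bigD1 u) //= [ltRHS](bigD1 u) //= ltr_leD // ler_sum // => x _; exact: r_ge.
Qed.

(** * The quadratic form of [Aalpha] *)

Lemma sum_enum_val (R : nmodType) (V : finType) (F : V -> R) :
  \sum_v F v = \sum_(i < #|V|) F (enum_val i).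
Proof.
by rewrite (reindex (@enum_val V (mem V))) //; exact/onW_bij/enum_val_bij.
Qed.

Lemma Aalpha_tr (R : realType) (V : finType) (e : rel V) (alpha : R) :
  symmetric e -> (Aalpha e alpha)^T = Aalpha e alpha.
Proof.
move=> e_sym; rewrite linearD !linearZ /= tr_diag_mx; congr (_ + _ *: _).
by apply/matrixP => i j; rewrite !mxE e_sym.
Qed.

Lemma Aalpha_form (R : realType) (V : finType) (e : rel V) (alpha : R) (f : V -> R)
    (x := \row_i f (enum_val i) : 'rV[R]_#|V|) :
  (x *m Aalpha e alpha *m x^T) 0 0 =
  \sum_u \sum_v (e u v)%:R * (alpha * f u ^+ 2 + (1 - alpha) * (f u * f v)).
Proof.
have degE u : (degree e u)%:R = \sum_v (e u v)%:R :> R.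
  rewrite /degree -sum1_card natr_sum big_mkcond /=.
  by apply: eq_bigr => v _; rewrite inE; case: e.
rewrite /Aalpha mulmxDr mulmxDl -!scalemxAr -!scalemxAl mul_mx_diag.
pose D := \sum_u \sum_v (e u v)%:R * f u ^+ 2.
pose B := \sum_u \sum_v (e u v)%:R * (f u * f v).
transitivity (alpha * D + (1 - alpha) * B); last first.
  rewrite /D /B !mulr_sumr -big_split; apply: eq_bigr => u _ /=.
  by rewrite !mulr_sumr -big_split; apply: eq_bigr => v _ /=; ring.
rewrite mxE [X in X + _]mxE [X in _ + X]mxE; congr (_ * _ + _ * _).
  rewrite mxE /D [RHS]sum_enum_val.
  apply: eq_bigr => i _; rewrite !mxE degE mulr_sumr mulr_suml.
  by apply: eq_bigr => v _; ring.
rewrite mxE /B exchange_big [RHS]sum_enum_val.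
apply: eq_bigr => j _; rewrite !mxE mulr_suml [RHS]sum_enum_val.
by apply: eq_bigr => i _; rewrite !mxE; ring.
Qed.

(** * Test vectors from a matching *)

Lemma lt_lambda_matching (R : realType) (V : finType) (e : rel V) (alpha : R)
    (M : {set {set V}}) :
  simple_graph e -> connected_graph e -> 1 / 2 <= alpha -> alpha <= 1 ->
  is_matching e M -> (0 < #|M|)%N -> (2 * #|M| < #|V|)%N ->
  1 < lambda #|M| (Aalpha e alpha).
Proof.
move=> [e_sym e_irr] [_ e_conn] al_ge al_le /andP[/subsetP Me trivM] M0 MV.
have edgeP E : E \in M -> exists u v, e u v /\ E = [set u; v].
  by move=> /Me /imsetP[[u v]]; rewrite inE /= => uv ->; exists u, v.
(* The rows are the indicator vectors of the matching edges, so [c *m W] takes the value [c 0 j] on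
   the [j]-th edge. *)
pose W := \matrix_(j < #|M|, i < #|V|) ((enum_val i \in (enum_val j : {set V}))%:R : R).
apply: (lt_lambda_of_form (W := W)) => // [|c c0]; first exact: Aalpha_tr.
pose f v := \sum_j c 0 j * (v \in (enum_val j : {set V}))%:R.
have fE v j : v \in (enum_val j : {set V}) -> f v = c 0 j.
  move=> vj; rewrite /f (bigD1 j) //= vj mulr1 big1 ?addr0 // => l lj.
  have /trivIsetP/(_ _ _ (enum_valP l) (enum_valP j)) := trivM.
  rewrite (inj_eq enum_val_inj) => /(_ lj) /pred0P/(_ v) /=.
  by rewrite vj andbT => ->; rewrite mulr0.
have f0 v : v \notin cover M -> f v = 0.
  move=> vM; rewrite /f big1 // => j _.
  case: (boolP (_ \in _)) => [vj|]; last by rewrite mulr0.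
  by case/negP: vM; apply/bigcupP; exists (enum_val j) => //; exact: enum_valP.
pose x : 'rV[R]_#|V| := \row_i f (enum_val i).
have cW : c *m W = x.
  by apply/rowP => i; rewrite !mxE; apply: eq_bigr => j _; rewrite !mxE.
rewrite !mulmxA -[c *m W *m _ *m _ *m _]mulmxA -trmx_mul cW.
rewrite mulmxBr mulmxBl mul_mx_scalar scale1r mxE Aalpha_form mxE subr_gt0.
have -> : (x *m x^T) 0 0 = \sum_u f u ^+ 2.
  rewrite mxE [RHS]sum_enum_val.
  by apply: eq_bigr => i _; rewrite !mxE expr2.
(* Edges have at most two vertices, so [M] covers at most [2 * #|M|] of them. *)
have [w wM] : exists w, w \notin cover M.
  apply/existsP; rewrite -negb_forall; apply/negP => /forallP all_cov.
  have : (#|V| <= #|cover M|)%N by apply/subset_leq_card/subsetP => v _; exact: all_cov.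
  rewrite leqNgt => /negP[]; apply: leq_ltn_trans MV.
  rewrite (leq_trans (leq_card_cover _)) // mulnC -sum_nat_const leq_sum //.
  move=> E /edgeP[u [v [_ ->]]].
  by rewrite cards2; case: (_ != _).
have [j cj] : exists j, c 0 j != 0 by apply/rV0Pn.
have [z [z' [_ zE]]] := edgeP _ (enum_valP j).
apply: (signless_form_gt (w := w) (z := z)) => //.
(* The partner of [u] is the other end of its matching edge. *)
- move=> u fu; have : u \in cover M by apply: contraNT fu => /f0 ->.
  case/bigcupP => E EM; have [a [b [ab EE]]] := edgeP E EM.
  have EI : E = enum_val (enum_rank_in EM E) by rewrite enum_rankK_in.
  rewrite EE !inE => /orP[]/eqP ->; [exists b|exists a]; rewrite // 1?e_sym //.
    by rewrite !(fE _ (enum_rank_in EM E)) // -EI EE !inE eqxx ?orbT.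
  by rewrite !(fE _ (enum_rank_in EM E)) // -EI EE !inE eqxx ?orbT.
- exact: f0.
- by rewrite (fE _ j) // zE !inE eqxx.
Qed.

Theorem theorem3p3 (R : realType) (V : finType) (e : rel V) (alpha : R)
    (e_simple : simple_graph e) (e_conn : connected_graph e)
    (alpha_ge : 1 / 2 <= alpha) (alpha_le : alpha <= 1) :
  ((1 <= matching_number e)%N ->
   (2 * matching_number e < #|V|)%N ->
   1 < lambda (matching_number e) (Aalpha e alpha)) /\
  ((1 <= matching_number e - 1)%N ->
   #|V| = (2 * matching_number e)%N ->
   1 < lambda (matching_number e - 1)%N (Aalpha e alpha)).
Proof.
(* The empty matching guarantees that the maximum is attained. *)
have m0 : is_matching e set0.
  by rewrite /is_matching sub0set; apply/trivIsetP => A B; rewrite inE.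
have [M Mm MV] := eq_bigmax_cond (fun M : {set {set V}} => #|M|)
  (introT (card_gt0P (A := is_matching e)) (ex_intro _ set0 m0)).
rewrite -[\max_(_ in _) _]/(matching_number e) in MV.
split=> [m_gt0 V_gt|m_gt V_eq].
  by rewrite MV; apply: lt_lambda_matching; rewrite -?MV.
have [E EM] : exists E, E \in M.
  by apply/card_gt0P; rewrite -MV; lia.
(* Deleting one edge restores strictness: twice [#|M| - 1] is less than [#|V|]. *)
have cD : #|M :\ E| = (matching_number e - 1)%N by rewrite MV (cardsD1 E M) EM addKn.
rewrite -cD; apply: lt_lambda_matching => //; rewrite ?cD //; last by lia.
have /andP[Me trivM] := Mm.
by rewrite /is_matching (subset_trans (subsetDl _ _)) // (trivIsetS (subsetDl _ _)).
Qed.
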